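(* $\widehat{\mathsf{WF}}\equiv_{sW}\mathsf S_{\vec L}$.
   Context: $\equiv_{sW}$ denotes strong Weihrauch equivalence. $\widehat{\mathsf{WF}}$: given a sequence $\langle T_i\rangle_{i\in\mathbb N}$ of trees $T_i\subseteq\mathbb N^{<\mathbb N}$, output $w:\mathbb N\to 2$ with $w(i)=0$ if $T_i$ contains an infinite path and $w(i)=1$ otherwise. $L$ is the linear graph with vertices $\{v_i:i\in\mathbb N\}$ and edges $\{(v_i,v_{i+1})\}$; for $n\in\mathbb N$, $L_n$ is $L$ with a cycle of size $n+3$ appended to the first vertex $v_0$ (e.g. $L_0$ is $L$ with a triangle attached at $v_0$). $\mathsf S_{\vec L}$: given a graph $G$, output $s:\mathbb N\to 2$ such that $s(n)=1$ iff $L_n$ is isomorphic to a subgraph of $G$. *)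

(* Defs.v *)
From Stdlib Require Import Arith Cantor List Lia.
From Stdlib Require Import Classical ClassicalEpsilon.
From Stdlib Require Import FunctionalExtensionality PropExtensionality ProofIrrelevance.
Import ListNotations.

Definition baire := nat -> nat.

Definition pr (x y : nat) : nat := Cantor.to_nat (x, y).
Definition pr1 (z : nat) : nat := fst (Cantor.of_nat z).
Definition pr2 (z : nat) : nat := snd (Cantor.of_nat z).

(** Partial recursive functions relative to an oracle, in Kleene's presentation
    by unary functions: several arguments are packed with the Cantor pairing,
    which is a bijection between [nat * nat] and [nat]. *)
Inductive code : Set :=
| Zero | Succ | Fst | Snd
| Oracle
| Pair (f g : code)
| Comp (f g : code)
| Prec (f g : code)
| Mu (f : code).

(** [eval p c x y]: program [c] with oracle [p] halts on input [x] with output [y]. *)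
Inductive eval (p : baire) : code -> nat -> nat -> Prop :=
| eval_Zero x : eval p Zero x 0
| eval_Succ x : eval p Succ x (S x)
| eval_Fst x : eval p Fst x (pr1 x)
| eval_Snd x : eval p Snd x (pr2 x)
| eval_Oracle x : eval p Oracle x (p x)
| eval_Pair f g x a b :
    eval p f x a -> eval p g x b -> eval p (Pair f g) x (pr a b)
| eval_Comp f g x a b :
    eval p g x a -> eval p f a b -> eval p (Comp f g) x b
| eval_Prec_0 f g x a :
    eval p f x a -> eval p (Prec f g) (pr x 0) a
| eval_Prec_S f g x n r a :
    eval p (Prec f g) (pr x n) r -> eval p g (pr x (pr n r)) a ->
    eval p (Prec f g) (pr x (S n)) a
| eval_Mu f x n (k : nat -> nat) :
    (forall m, m < n -> eval p f (pr x m) (S (k m))) ->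
    eval p f (pr x n) 0 ->
    eval p (Mu f) x n.

(** The partial function on Baire space computed by [c], as a graph: [p] is in
    its domain when [c] with oracle [p] halts on every input. *)
Definition functional (c : code) (p q : baire) : Prop :=
  forall n, eval p c n (q n).

Lemma pr_inj x y x' y' : pr x y = pr x' y' -> x = x' /\ y = y'.
Proof.
  unfold pr. intros H. apply Cantor.to_nat_inj in H. injection H. auto.
Qed.

Lemma pr1_pr x y : pr1 (pr x y) = x.
Proof. unfold pr1, pr. now rewrite Cantor.cancel_of_to. Qed.

Lemma pr2_pr x y : pr2 (pr x y) = y.
Proof. unfold pr2, pr. now rewrite Cantor.cancel_of_to. Qed.

Lemma eval_det p c x y y' : eval p c x y -> eval p c x y' -> y = y'.
Proof.
  intros H. revert y'.
  induction H as [| | | | |f g x a b _ IHf _ IHg|f g x a b _ IHg _ IHf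
                  |f g x a _ IHf|f g x n r a _ IHr _ IHg
                  |f x n k _ IHlt _ IHn]; intros y' H';
    try match type of H' with eval _ (Prec _ _) ?z _ => remember z as z0 eqn:E end;
    inversion H'; subst; auto;
    repeat match goal with
    | E : pr _ _ = pr _ _ |- _ => apply pr_inj in E as [? ?]; subst
    | E : S _ = S _ |- _ => injection E as E; subst
    end; try discriminate.
  - match goal with Hg : eval p g x _ |- _ => apply IHg in Hg; subst end. auto.
  - auto.
  - match goal with Hr : eval p (Prec f g) _ _ |- _ => apply IHr in Hr; subst end.
    auto.
  - destruct (lt_eq_lt_dec n y') as [[l|e]|l]; auto.
    + match goal with Hlt : forall m, m < y' -> _ |- _ =>
        discriminate (IHn _ (Hlt n l)) end.
    + match goal with Hn : eval p f (pr x y') 0 |- _ =>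
        discriminate (IHlt _ l _ Hn) end.
Qed.

Lemma functional_det c p q q' : functional c p q -> functional c p q' -> q = q'.
Proof.
  intros H H'. extensionality n. exact (eval_det _ _ _ _ _ (H n) (H' n)).
Qed.

(** [name] is the graph of a partial surjection from Baire space onto [point]. *)
Record rep_space := RepSpace {
  point :> Type;
  name : baire -> point -> Prop;
  name_fun : forall p x y, name p x -> name p y -> x = y;
  name_surj : forall x, exists p, name p x
}.
Arguments name {_} _ _.

(** A partial multi-valued function; [f x y] means that [y] is a solution of
    the instance [x]. *)
Definition problem (X Y : rep_space) := X -> Y -> Prop.

Definition dom {X Y : rep_space} (f : problem X Y) (x : X) : Prop :=
  exists y, f x y.

Definition sW_le {X Y Z W : rep_space} (f : problem X Y) (g : problem Z W) : Prop :=
  exists Phi Psi : code,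
  forall (p : baire) (x : X), name p x -> dom f x ->
  exists (r : baire) (z : Z),
    functional Phi p r /\ name r z /\ dom g z /\
    forall (q : baire) (w : W), name q w -> g z w ->
    exists (t : baire) (y : Y), functional Psi q t /\ name t y /\ f x y.

Definition sW_equiv {X Y Z W : rep_space} (f : problem X Y) (g : problem Z W) : Prop :=
  sW_le f g /\ sW_le g f.

Definition char_val (P : Prop) (n : nat) : Prop := (P /\ n = 1) \/ (~ P /\ n = 0).

Lemma char_val_eq P Q n : char_val P n -> char_val Q n -> P = Q.
Proof.
  intros [[HP E]|[HP E]] [[HQ E']|[HQ E']]; subst; try discriminate;
    apply propositional_extensionality; tauto.
Qed.

Definition char_of (P : Prop) : nat := if excluded_middle_informative P then 1 else 0.

Lemma char_ofP P : char_val P (char_of P).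
Proof.
  unfold char_of, char_val. destruct (excluded_middle_informative P); tauto.
Qed.

Definition cantor_name (p : baire) (w : nat -> bool) : Prop :=
  forall n, p n = if w n then 1 else 0.

Lemma cantor_name_fun p w w' : cantor_name p w -> cantor_name p w' -> w = w'.
Proof.
  intros H H'. extensionality n. specialize (H n). specialize (H' n).
  destruct (w n), (w' n); congruence.
Qed.

Lemma cantor_name_surj w : exists p, cantor_name p w.
Proof. now exists (fun n => if w n then 1 else 0). Qed.

Definition cantor : rep_space :=
  RepSpace (nat -> bool) cantor_name cantor_name_fun cantor_name_surj.

Definition seq_name (X : rep_space) (p : baire) (x : nat -> X) : Prop :=
  forall i, name (fun n => p (pr i n)) (x i).

Lemma seq_name_fun X p x y : seq_name X p x -> seq_name X p y -> x = y.
Proof.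
  intros H H'. extensionality i. exact (name_fun X _ _ _ (H i) (H' i)).
Qed.

Lemma seq_name_surj X x : exists p, seq_name X p x.
Proof.
  pose (q i := proj1_sig (constructive_indefinite_description _ (name_surj X (x i)))).
  exists (fun m => q (pr1 m) (pr2 m)). intros i.
  replace (fun n => _) with (q i).
  - exact (proj2_sig (constructive_indefinite_description _ (name_surj X (x i)))).
  - extensionality n. now rewrite pr1_pr, pr2_pr.
Qed.

Definition seq_space (X : rep_space) : rep_space :=
  RepSpace (nat -> X) (seq_name X) (seq_name_fun X) (seq_name_surj X).

Record tree := Tree {
  node : list nat -> Prop;
  node_prefix : forall s t, node (s ++ t) -> node s
}.

Definition has_path (T : tree) : Prop :=
  exists f : nat -> nat, forall n, node T (map f (seq 0 n)).

Fixpoint list_code (s : list nat) : nat :=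
  match s with
  | [] => 0
  | x :: s' => S (pr x (list_code s'))
  end.

Lemma list_code_inj s t : list_code s = list_code t -> s = t.
Proof.
  revert t. induction s as [|x s IH]; intros [|y t]; simpl; try easy.
  intros [= H]. apply pr_inj in H as [-> H]. f_equal. auto.
Qed.

Lemma list_code_surj m : exists s, list_code s = m.
Proof.
  induction m as [[|m] IH] using (well_founded_induction lt_wf).
  - now exists [].
  - destruct (Cantor.of_nat m) as [x y] eqn:E.
    assert (Hm : Cantor.to_nat (x, y) = m)
      by (rewrite <- E; apply Cantor.cancel_to_of).
    destruct (IH y) as [s Hs].
    + pose proof (Cantor.to_nat_non_decreasing x y). lia.
    + exists (x :: s). simpl. unfold pr. now rewrite Hs, Hm.
Qed.

Definition tree_name (p : baire) (T : tree) : Prop :=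
  forall s, char_val (node T s) (p (list_code s)).

Lemma tree_name_fun p T T' : tree_name p T -> tree_name p T' -> T = T'.
Proof.
  destruct T as [N HN], T' as [N' HN']. intros H H'.
  assert (E : N = N')
    by (extensionality s; exact (char_val_eq _ _ _ (H s) (H' s))).
  subst N'. f_equal. apply proof_irrelevance.
Qed.

Lemma tree_name_surj T : exists p, tree_name p T.
Proof.
  exists (fun m => char_of (exists s, list_code s = m /\ node T s)). intros s.
  replace (node T s) with (exists t, list_code t = list_code s /\ node T t).
  - apply char_ofP.
  - apply propositional_extensionality. split.
    + intros (t & E & H). now apply list_code_inj in E as ->.
    + eauto.
Qed.

Definition tree_space : rep_space :=
  RepSpace tree tree_name tree_name_fun tree_name_surj.

(** Countable undirected loop-free graphs whose vertices are natural numbers. *)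
Record graph := Graph {
  vertex : nat -> Prop;
  edge : nat -> nat -> Prop;
  edge_vertex : forall i j, edge i j -> vertex i;
  edge_sym : forall i j, edge i j -> edge j i;
  edge_irrefl : forall i, ~ edge i i
}.

(** The diagonal of the adjacency matrix carries the vertex set. *)
Definition graph_name (p : baire) (G : graph) : Prop :=
  (forall i, char_val (vertex G i) (p (pr i i))) /\
  (forall i j, i <> j -> char_val (edge G i j) (p (pr i j))).

Lemma graph_name_fun p G G' : graph_name p G -> graph_name p G' -> G = G'.
Proof.
  destruct G as [V E Hv Hs Hi], G' as [V' E' Hv' Hs' Hi'].
  intros [H1 H2] [H1' H2']; simpl in *.
  assert (V = V')
    by (extensionality i; exact (char_val_eq _ _ _ (H1 i) (H1' i))).
  assert (E = E').
  { extensionality i; extensionality j. destruct (Nat.eq_dec i j) as [->|n].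
    - apply propositional_extensionality.
      split; intro e; [now destruct (Hi j)|now destruct (Hi' j)].
    - exact (char_val_eq _ _ _ (H2 i j n) (H2' i j n)). }
  subst V' E'. f_equal; apply proof_irrelevance.
Qed.

Lemma graph_name_surj G : exists p, graph_name p G.
Proof.
  exists (fun m => if Nat.eq_dec (pr1 m) (pr2 m) then char_of (vertex G (pr1 m))
                   else char_of (edge G (pr1 m) (pr2 m))).
  split.
  - intros i. rewrite pr1_pr, pr2_pr.
    destruct (Nat.eq_dec i i); [apply char_ofP|easy].
  - intros i j n. rewrite pr1_pr, pr2_pr.
    destruct (Nat.eq_dec i j); [easy|apply char_ofP].
Qed.

Definition graph_space : rep_space :=
  RepSpace graph graph_name graph_name_fun graph_name_surj.

Definition subgraph (H G : graph) : Prop :=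
  (forall i, vertex H i -> vertex G i) /\ (forall i j, edge H i j -> edge G i j).

Definition isomorphic (H G : graph) : Prop :=
  exists f : nat -> nat,
    (forall i, vertex H i -> vertex G (f i)) /\
    (forall i j, vertex H i -> vertex H j -> f i = f j -> i = j) /\
    (forall k, vertex G k -> exists i, vertex H i /\ f i = k) /\
    (forall i j, vertex H i -> vertex H j -> (edge H i j <-> edge G (f i) (f j))).

Definition WF_hat : problem (seq_space tree_space) cantor :=
  fun T w => forall i,
    (has_path (T i) -> w i = false) /\ (~ has_path (T i) -> w i = true).

Definition L_edge (i j : nat) : Prop := j = S i \/ i = S j.

Program Definition L : graph := {| vertex := fun _ => True; edge := L_edge |}.
Next Obligation. unfold L_edge in *. tauto. Qed.
Next Obligation. unfold L_edge. lia. Qed.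

(** In [L_cycle n] the numbers [0], ..., [n + 2] are the vertices of the cycle,
    in cyclic order, and the vertex [v_i] of [L] is the number [n + 2 + i]; the
    two parts share the vertex [v_0 = n + 2] and nothing else. *)
Definition cycle_step (m i j : nat) : Prop := i < m /\ j = S i mod m.

Definition L_cycle_edge (n a b : nat) : Prop :=
  cycle_step (n + 3) a b \/ cycle_step (n + 3) b a \/
  exists i j, edge L i j /\ a = n + 2 + i /\ b = n + 2 + j.

Lemma L_cycle_edge_sym n a b : L_cycle_edge n a b -> L_cycle_edge n b a.
Proof.
  intros [H|[H|(i & j & H & -> & ->)]]; unfold L_cycle_edge; auto.
  right; right. exists j, i. split; auto. now apply edge_sym.
Qed.

Lemma L_cycle_edge_irrefl n a : ~ L_cycle_edge n a a.
Proof.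
  assert (C : ~ cycle_step (n + 3) a a).
  { intros [H E]. destruct (Nat.eq_dec (S a) (n + 3)) as [E'|E'].
    - rewrite E', Nat.Div0.mod_same in E. lia.
    - rewrite Nat.mod_small in E; lia. }
  intros [H|[H|(i & j & H & E & E')]]; auto.
  apply (edge_irrefl L i). now replace j with i in H by lia.
Qed.

Definition L_cycle (n : nat) : graph :=
  {| vertex := fun _ => True;
     edge := L_cycle_edge n;
     edge_vertex := fun _ _ _ => I;
     edge_sym := L_cycle_edge_sym n;
     edge_irrefl := L_cycle_edge_irrefl n |}.

Definition S_L : problem graph_space cantor :=
  fun G s => forall n,
    s n = true <-> exists H : graph, subgraph H G /\ isomorphic (L_cycle n) H.

(* Main.v *)
(* Up to the numbering of Defs.v, [L_n] is the ray 0, 1, 2, ... with the chord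
   {0, n + 2}.  Hence the finite injective sequences that respect the edges of
   [L_n] form a tree, computable from [G], whose paths are the embeddings of
   [L_n] into [G].  Conversely, attach to the root of each [T_i] a cycle of
   length [i + 3] and take the disjoint union: a cycle of size [n + 3] in this
   graph can only be the one attached to [T_n], and an injective ray leaving it
   can never turn back, so it climbs a path of [T_n].  In both directions the
   answer bits are complemented. *)

From Stdlib Require Import Arith Bool Cantor List Lia Classical ClassicalEpsilon.
Require Import Defs.
Import ListNotations.

(** * Closure properties of the computable functionals *)

Definition computable (F : baire -> nat -> nat) : Prop :=
  exists c, forall p x, eval p c x (F p x).

Definition decidable (B : baire -> nat -> bool) : Prop :=
  computable (fun p x => Nat.b2n (B p x)).

Lemma computable_ext F G :
  (forall p x, F p x = G p x) -> computable F -> computable G.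
Proof. intros E [c H]. exists c. intros p x. rewrite <- E. apply H. Qed.

Lemma pr_eta z : pr (pr1 z) (pr2 z) = z.
Proof.
  unfold pr, pr1, pr2. rewrite <- surjective_pairing. apply Cantor.cancel_to_of.
Qed.

Lemma computable_id : computable (fun _ x => x).
Proof.
  exists (Pair Fst Snd). intros p x. rewrite <- (pr_eta x) at 2.
  repeat constructor.
Qed.

Lemma computable_0 : computable (fun _ _ => 0).
Proof. exists Zero. constructor. Qed.

Lemma computable_comp F G :
  computable F -> computable G -> computable (fun p x => F p (G p x)).
Proof.
  intros [c Hc] [d Hd]. exists (Comp c d). intros p x. econstructor; eauto.
Qed.

Lemma computable_S F : computable F -> computable (fun p x => S (F p x)).
Proof. apply (computable_comp (fun _ x => S x)). exists Succ. constructor. Qed.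

Lemma computable_pr1 F : computable F -> computable (fun p x => pr1 (F p x)).
Proof. apply (computable_comp (fun _ x => pr1 x)). exists Fst. constructor. Qed.

Lemma computable_pr2 F : computable F -> computable (fun p x => pr2 (F p x)).
Proof. apply (computable_comp (fun _ x => pr2 x)). exists Snd. constructor. Qed.

Lemma computable_oracle F : computable F -> computable (fun p x => p (F p x)).
Proof. apply (computable_comp (fun p x => p x)). exists Oracle. constructor. Qed.

Lemma computable_pr F G :
  computable F -> computable G -> computable (fun p x => pr (F p x) (G p x)).
Proof.
  intros [c Hc] [d Hd]. exists (Pair c d). intros p x. constructor; auto.
Qed.

Lemma computable_nat_rect F G N :
  computable F ->
  computable (fun p z => G p (pr1 z) (pr1 (pr2 z)) (pr2 (pr2 z))) ->
  computable N ->
  computable (fun p x => nat_rect (fun _ => nat) (F p x) (G p x) (N p x)).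
Proof.
  intros [f Hf] [g Hg] HN.
  assert (H : computable (fun p z =>
            nat_rect (fun _ => nat) (F p (pr1 z)) (G p (pr1 z)) (pr2 z))).
  { exists (Prec f g). intros p z. rewrite <- (pr_eta z) at 1.
    generalize (pr1 z) (pr2 z). clear z. intros x n.
    induction n as [|n IH]; simpl.
    - constructor. apply Hf.
    - econstructor; [exact IH|].
      specialize (Hg p (pr x (pr n (nat_rect (fun _ => nat) (F p x) (G p x) n)))).
      cbv beta in Hg. now rewrite !pr2_pr, !pr1_pr in Hg. }
  pose proof (computable_comp _ _ H (computable_pr _ _ computable_id HN)) as K.
  revert K. apply computable_ext. intros p x. now rewrite pr1_pr, pr2_pr.
Qed.

Lemma computable_iter A F N :
  computable A -> computable (fun p z => F p (pr1 z) (pr2 z)) -> computable N ->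
  computable (fun p x => Nat.iter (N p x) (F p x) (A p x)).
Proof.
  intros HA HF HN.
  apply (computable_nat_rect A (fun p x _ r => F p x r) N); auto.
  refine (computable_ext _ _ _
    (computable_comp _ (fun _ z => pr (pr1 z) (pr2 (pr2 z))) HF _)).
  - intros p z. cbv beta. now rewrite pr1_pr, pr2_pr.
  - auto using computable_pr, computable_pr1, computable_pr2, computable_id.
Qed.

Lemma computable_pred F : computable F -> computable (fun p x => pred (F p x)).
Proof.
  intros HF. apply (computable_ext
    (fun p x => nat_rect (fun _ => nat) 0 (fun n _ => n) (F p x))).
  - intros p x. now destruct (F p x).
  - apply (computable_nat_rect (fun _ _ => 0) (fun _ _ n _ => n));
      auto using computable_0, computable_pr1, computable_pr2, computable_id.
Qed.

Lemma computable_sub F G :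
  computable F -> computable G -> computable (fun p x => F p x - G p x).
Proof.
  intros HF HG.
  apply (computable_ext (fun p x => Nat.iter (G p x) pred (F p x))).
  - intros p x. induction (G p x) as [|n IH]; simpl; [|rewrite IH]; lia.
  - apply (computable_iter _ (fun _ _ r => pred r));
      auto using computable_pred, computable_pr2, computable_id.
Qed.

Lemma computable_if B F G :
  decidable B -> computable F -> computable G ->
  computable (fun p x => if B p x then F p x else G p x).
Proof.
  intros HB HF HG. apply (computable_ext
    (fun p x => nat_rect (fun _ => nat) (G p x) (fun _ _ => F p x) (Nat.b2n (B p x)))).
  - intros p x. now destruct (B p x).
  - apply (computable_nat_rect _ (fun p x _ _ => F p x)); auto.
    apply (computable_comp F); auto using computable_pr1, computable_id.
Qed.

Lemma computable_b2n B : decidable B -> computable (fun p x => Nat.b2n (B p x)).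
Proof. auto. Qed.

Lemma decidable_true : decidable (fun _ _ => true).
Proof. exact (computable_S _ computable_0). Qed.

Lemma decidable_false : decidable (fun _ _ => false).
Proof. exact computable_0. Qed.

Lemma decidable_if A B C :
  decidable A -> decidable B -> decidable C ->
  decidable (fun p x => if A p x then B p x else C p x).
Proof.
  intros HA HB HC. refine (computable_ext _ _ _ (computable_if _ _ _ HA HB HC)).
  intros p x. now destruct (A p x).
Qed.

Lemma decidable_andb A B :
  decidable A -> decidable B -> decidable (fun p x => A p x && B p x).
Proof. intros. apply decidable_if; auto using decidable_false. Qed.

Lemma decidable_orb A B :
  decidable A -> decidable B -> decidable (fun p x => A p x || B p x).
Proof. intros. apply decidable_if; auto using decidable_true. Qed.

Lemma decidable_negb A : decidable A -> decidable (fun p x => negb (A p x)).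
Proof. intros. apply decidable_if; auto using decidable_true, decidable_false. Qed.

Lemma decidable_leb F G :
  computable F -> computable G -> decidable (fun p x => F p x <=? G p x).
Proof.
  intros HF HG. apply (computable_ext (fun p x => 1 - (F p x - G p x))).
  - intros p x. destruct (Nat.leb_spec (F p x) (G p x)); cbn [Nat.b2n]; lia.
  - auto using computable_sub, computable_S, computable_0.
Qed.

Lemma decidable_ltb F G :
  computable F -> computable G -> decidable (fun p x => F p x <? G p x).
Proof. intros. apply decidable_leb; auto using computable_S. Qed.

Lemma decidable_eqb F G :
  computable F -> computable G -> decidable (fun p x => F p x =? G p x).
Proof.
  intros HF HG.
  refine (computable_ext _ _ _ (decidable_andb _ _
    (decidable_leb _ _ HF HG) (decidable_leb _ _ HG HF))).
  intros p x.
  destruct (Nat.eqb_spec (F p x) (G p x)), (Nat.leb_spec (F p x) (G p x)),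
    (Nat.leb_spec (G p x) (F p x)); simpl; lia.
Qed.

Lemma decidable_forallb B N :
  decidable (fun p z => B p (pr1 z) (pr2 z)) -> computable N ->
  decidable (fun p x => forallb (B p x) (seq 0 (N p x))).
Proof.
  intros HB HN. apply (computable_ext (fun p x => nat_rect (fun _ => nat) 1
    (fun n r => if r =? 0 then 0 else Nat.b2n (B p x n)) (N p x))).
  - intros p x. induction (N p x) as [|n IH]; [easy|].
    rewrite seq_S, forallb_app. cbn [nat_rect]. rewrite IH. simpl.
    destruct (forallb (B p x) (seq 0 n)), (B p x n); reflexivity.
  - apply (computable_nat_rect (fun _ _ => 1)
      (fun p x n r => if r =? 0 then 0 else Nat.b2n (B p x n)));
      auto using computable_S, computable_0.
    apply computable_if; [apply decidable_eqb| |];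
      auto using computable_0, computable_pr2, computable_id.
    refine (computable_ext _ _ _
      (computable_comp _ (fun _ z => pr (pr1 z) (pr1 (pr2 z))) HB _)).
    + intros p z. cbv beta. now rewrite pr1_pr, pr2_pr.
    + auto using computable_pr, computable_pr1, computable_pr2, computable_id.
Qed.

Ltac computability_step :=
  cbv beta;
  lazymatch goal with
  | |- decidable (fun p x => _ && _) => apply decidable_andb
  | |- decidable (fun p x => _ || _) => apply decidable_orb
  | |- decidable (fun p x => negb _) => apply decidable_negb
  | |- decidable (fun p x => if _ then _ else _) => apply decidable_if
  | |- decidable (fun p x => _ =? _) => apply decidable_eqb
  | |- decidable (fun p x => _ <? _) => apply decidable_ltb
  | |- decidable (fun p x => forallb (@?B p x) _) => apply (decidable_forallb B)
  | |- computable (fun p x => Nat.b2n _) => apply computable_b2n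
  | |- computable (fun p x => if _ then _ else _) => apply computable_if
  | |- computable (fun p x => Nat.iter _ (@?F p x) _) => apply (computable_iter _ F)
  | |- computable (fun p x => pr _ _) => apply computable_pr
  | |- computable (fun p x => pr1 _) => apply computable_pr1
  | |- computable (fun p x => pr2 _) => apply computable_pr2
  | |- computable (fun p x => pred _) => apply computable_pred
  | |- computable (fun p x => _ - _) => apply computable_sub
  | |- computable (fun p x => 0) => apply computable_0
  | |- computable (fun p x => S _) => apply computable_S
  | |- computable (fun p x => x) => apply computable_id
  | |- computable (fun p x => p _) => apply computable_oracle
  end.

Ltac computability := repeat computability_step.

Lemma sW_le_complement {X Z : rep_space} (f : problem X cantor)
    (g : problem Z cantor) (F : baire -> baire) (h : X -> Z) :
  computable F ->
  (forall p x, name p x -> name (F p) (h x)) ->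
  (forall z, dom g z) ->
  (forall x w, g (h x) w -> f x (fun n => negb (w n))) ->
  sW_le f g.
Proof.
  intros [Phi HPhi] Hname Hdom Hsol.
  assert (Hneg : computable (fun q n => 1 - q n)) by computability.
  destruct Hneg as [Psi HPsi].
  exists Phi, Psi. intros p x Hp _. exists (F p), (h x).
  repeat split; auto; [intros n; apply HPhi|].
  intros q w Hq Hw. exists (fun n => 1 - q n), (fun n => negb (w n)).
  repeat split; auto; [intros n; apply HPsi|].
  intros n. rewrite (Hq n). now destruct (w n).
Qed.

Lemma char_val_b2n P b : (b = true <-> P) -> char_val P (Nat.b2n b).
Proof. intros H. destruct b; [left|right]; intuition discriminate. Qed.

Lemma char_val_eq1 P n : char_val P n -> (n =? 1) = true <-> P.
Proof.
  rewrite Nat.eqb_eq. intros [[H ->]|[H ->]]; split; try tauto; discriminate.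
Qed.

(** * Embeddings of the graphs L_n *)

(* [L_cycle n] is the ray 0, 1, 2, ... together with the chord {0, n + 2}. *)
Lemma L_cycle_edge_iff n a b :
  L_cycle_edge n a b <->
  b = S a \/ a = S b \/ (a = 0 /\ b = n + 2) \/ (a = n + 2 /\ b = 0).
Proof.
  assert (C : forall i j, cycle_step (n + 3) i j <->
            (i < n + 2 /\ j = S i) \/ (i = n + 2 /\ j = 0)).
  { intros i j. unfold cycle_step. destruct (Nat.eq_dec i (n + 2)) as [->|Hi].
    - replace (S (n + 2)) with (n + 3) by lia. rewrite Nat.Div0.mod_same. lia.
    - split; [intros [H E]|intros H]; [|split; [lia|]];
        rewrite Nat.mod_small in *; lia. }
  unfold L_cycle_edge. rewrite !C. simpl. unfold L_edge. split.
  - intros [H|[H|(i & j & H)]]; lia.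
  - intros H. destruct (le_lt_dec (n + 2) a), (le_lt_dec (n + 2) b);
      try (left; lia); try (right; left; lia);
      destruct H as [H|[H|H]]; try lia;
      right; right; exists (a - (n + 2)), (b - (n + 2)); lia.
Qed.

Definition embedding (n : nat) (G : graph) (f : nat -> nat) : Prop :=
  (forall a b, f a = f b -> a = b) /\
  (forall a, edge G (f a) (f (S a))) /\
  edge G (f 0) (f (n + 2)).

Lemma subgraph_L_cycle_iff n G :
  (exists H, subgraph H G /\ isomorphic (L_cycle n) H) <->
  exists f, embedding n G f.
Proof.
  split.
  - intros (H & [_ HE] & f & Hv & Hinj & _ & Hedge). simpl in Hv, Hinj, Hedge.
    exists f. repeat split; auto; intros; apply HE, Hedge; auto;
      apply L_cycle_edge_iff; auto.
  - intros (f & Hinj & Hstep & Hchord).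
    assert (Hedge : forall a b, L_cycle_edge n a b -> edge G (f a) (f b)).
    { intros a b Hab. apply L_cycle_edge_iff in Hab.
      destruct Hab as [->|[->|[[-> ->]|[-> ->]]]]; auto using edge_sym. }
    unshelve eexists (Graph (fun k => exists a, f a = k)
      (fun u v => exists a b, L_cycle_edge n a b /\ f a = u /\ f b = v) _ _ _).
    + intros u v (a & b & _ & Ha & _). eauto.
    + intros u v (a & b & Hab & Ha & Hb). exists b, a.
      auto using L_cycle_edge_sym.
    + intros u (a & b & Hab & Ha & Hb). subst u. apply Hinj in Hb. subst b.
      exact (L_cycle_edge_irrefl n a Hab).
    + split; [split; simpl|].
      * intros k [a <-]. exact (edge_vertex _ _ _ (Hstep a)).
      * intros u v (a & b & Hab & <- & <-). auto.
      * exists f. simpl. repeat split; eauto.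
        -- intros k [a <-]. eauto.
        -- intros (a & b & Hab & Ha & Hb).
           apply Hinj in Ha, Hb. now subst a b.
Qed.

Lemma S_L_total G : dom S_L G.
Proof.
  exists (fun n => if excluded_middle_informative (exists f, embedding n G f)
                   then true else false).
  intros n. rewrite subgraph_L_cycle_iff.
  destruct (excluded_middle_informative _); split; easy.
Qed.

Lemma WF_hat_total T : dom WF_hat T.
Proof.
  exists (fun i => if excluded_middle_informative (has_path (T i))
                   then false else true).
  intros i. destruct (excluded_middle_informative _); split; easy.
Qed.

(** * Finite partial embeddings as trees *)

Definition partial_embedding (n : nat) (G : graph) (s : list nat) : Prop :=
  forall a b, a < b < length s ->
  nth a s 0 <> nth b s 0 /\
  (b = S a \/ (a = 0 /\ b = S (S n)) -> edge G (nth a s 0) (nth b s 0)).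

Lemma partial_embedding_prefix n G s t :
  partial_embedding n G (s ++ t) -> partial_embedding n G s.
Proof.
  intros H a b Hab. specialize (H a b). rewrite length_app in H.
  rewrite !app_nth1 in H by lia. apply H. lia.
Qed.

Definition embedding_tree (G : graph) (n : nat) : tree :=
  Tree (partial_embedding n G) (partial_embedding_prefix n G).

Lemma nth_map_seq (f : nat -> nat) k a : a < k -> nth a (map f (seq 0 k)) 0 = f a.
Proof.
  intros H. rewrite (nth_indep _ 0 (f 0)) by now rewrite length_map, length_seq.
  now rewrite map_nth, seq_nth.
Qed.

Lemma embedding_tree_path G n :
  has_path (embedding_tree G n) <-> exists f, embedding n G f.
Proof.
  split; intros [f Hf]; exists f.
  - assert (H : forall a b, a < b -> f a <> f b /\
              (b = S a \/ (a = 0 /\ b = S (S n)) -> edge G (f a) (f b))).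
    { intros a b Hab. specialize (Hf (S b) a b).
      rewrite length_map, length_seq in Hf.
      rewrite !nth_map_seq in Hf by lia. apply Hf. lia. }
    repeat split.
    + intros a b E. destruct (lt_eq_lt_dec a b) as [[l| ]|l]; auto;
        destruct (proj1 (H _ _ l)); auto.
    + intros a. apply H; lia.
    + apply H; lia.
  - destruct Hf as (Hinj & Hstep & Hchord). intros k a b Hab.
    rewrite length_map, length_seq in Hab. rewrite !nth_map_seq by lia. split.
    + intros E. apply Hinj in E. lia.
    + intros [->|[-> ->]]; auto.
      replace (S (S n)) with (n + 2) by lia. auto.
Qed.

Definition code_drop (a c : nat) : nat := Nat.iter a (fun c => pr2 (pred c)) c.

Definition code_nth (a c : nat) : nat := pr1 (pred (code_drop a c)).

Lemma code_drop_list_code a s : code_drop a (list_code s) = list_code (skipn a s).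
Proof.
  revert s. induction a as [|a IH]; intros s; [easy|].
  unfold code_drop in *. rewrite Nat.iter_succ_r.
  destruct s as [|x s]; cbn [list_code skipn pred].
  - exact (eq_trans (IH []) (f_equal list_code (skipn_nil _ a))).
  - now rewrite pr2_pr.
Qed.

Lemma code_nth_list_code a s : code_nth a (list_code s) = nth a s 0.
Proof.
  unfold code_nth. rewrite code_drop_list_code. revert s.
  induction a as [|a IH]; intros [|x s]; simpl; auto. apply pr1_pr.
Qed.

Lemma code_drop_eq0 a s : code_drop a (list_code s) = 0 <-> length s <= a.
Proof.
  rewrite code_drop_list_code. pose proof (length_skipn a s) as H.
  destruct (skipn a s); simpl in *; lia.
Qed.

Lemma length_le_list_code s : length s <= list_code s.
Proof.
  induction s as [|x s IH]; simpl; [easy|].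
  pose proof (Cantor.to_nat_non_decreasing x (list_code s)). unfold pr. lia.
Qed.

Definition partial_embedding_test (p : baire) (n c : nat) : bool :=
  forallb (fun a => forallb (fun b =>
    negb ((a <? b) && negb (code_drop b c =? 0)) ||
    (negb (code_nth a c =? code_nth b c) &&
     (negb ((b =? S a) || ((a =? 0) && (b =? S (S n)))) ||
      (p (pr (code_nth a c) (code_nth b c)) =? 1)))) (seq 0 c)) (seq 0 c).

Lemma partial_embedding_testP p G n s :
  graph_name p G ->
  partial_embedding_test p n (list_code s) = true <-> partial_embedding n G s.
Proof.
  intros [_ HE]. pose proof (length_le_list_code s) as Hlen.
  assert (Hpair : forall a b,
    negb ((a <? b) && negb (code_drop b (list_code s) =? 0)) ||
    (negb (code_nth a (list_code s) =? code_nth b (list_code s)) &&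
     (negb ((b =? S a) || ((a =? 0) && (b =? S (S n)))) ||
      (p (pr (code_nth a (list_code s)) (code_nth b (list_code s))) =? 1))) = true
    <-> (a < b < length s ->
         nth a s 0 <> nth b s 0 /\
         (b = S a \/ (a = 0 /\ b = S (S n)) -> edge G (nth a s 0) (nth b s 0)))).
  { intros a b. rewrite !code_nth_list_code.
    pose proof (code_drop_eq0 b s) as Hd.
    destruct (Nat.eq_dec (nth a s 0) (nth b s 0)) as [e|ne].
    - rewrite <- e, Nat.eqb_refl. simpl. rewrite orb_false_r, negb_true_iff,
        andb_false_iff, negb_false_iff, Nat.ltb_ge, Nat.eqb_eq, Hd.
      split; [intros H1 H2; lia|]. intros H.
      destruct (le_lt_dec b a), (le_lt_dec (length s) b); auto. now destruct H.
    - rewrite <- (char_val_eq1 _ _ (HE _ _ ne)).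
      rewrite (proj2 (Nat.eqb_neq _ _) ne). simpl.
      rewrite !orb_true_iff, !negb_true_iff, andb_false_iff, orb_false_iff,
        andb_false_iff, negb_false_iff, Nat.ltb_ge, !Nat.eqb_neq, Nat.eqb_eq, Hd.
      generalize (p (pr (nth a s 0) (nth b s 0)) =? 1). intros e.
      split; [|intros H].
      + intros H1 H2. split; [easy|]. intros H3.
        destruct H1 as [H1|[H1|H1]]; [lia|lia|auto].
      + destruct (le_lt_dec b a), (le_lt_dec (length s) b); auto.
        destruct H as [_ H]; auto. right.
        destruct (Nat.eq_dec b (S a)), (Nat.eq_dec a 0), (Nat.eq_dec b (S (S n)));
          auto; left; lia. }
  unfold partial_embedding_test, partial_embedding.
  rewrite forallb_forall. setoid_rewrite forallb_forall.
  setoid_rewrite Hpair. setoid_rewrite in_seq.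
  split; intros H a; [intros b Hab|intros _ b _]; apply H; lia.
Qed.

Definition embedding_tree_name (p : baire) (m : nat) : nat :=
  Nat.b2n (partial_embedding_test p (pr1 m) (pr2 m)).

Lemma computable_embedding_tree_name : computable embedding_tree_name.
Proof.
  unfold embedding_tree_name, partial_embedding_test, code_nth, code_drop.
  computability.
Qed.

Lemma S_L_le_WF_hat : sW_le S_L WF_hat.
Proof.
  apply (sW_le_complement (X := graph_space) (Z := seq_space tree_space)
           S_L WF_hat embedding_tree_name embedding_tree).
  - apply computable_embedding_tree_name.
  - intros p G HG n s. unfold embedding_tree_name. rewrite pr1_pr, pr2_pr.
    apply char_val_b2n. now apply partial_embedding_testP.
  - apply WF_hat_total.
  - intros G w Hw n. rewrite subgraph_L_cycle_iff, <- embedding_tree_path.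
    destruct (Hw n) as [H1 H2]. rewrite negb_true_iff. split; auto.
    intros E. apply NNPP. intros H. rewrite H2 in E; easy.
Qed.

(** * Trees with a cycle at the root *)

(* A vertex is [pr i (pr k c)] for a component [i].  The [k <= i + 2] with
   [c = 0] form a cycle of length [i + 3]; its vertex with [k = i + 2] is the
   root of a copy of [T i], in which the node [s] has [c = list_code (rev s)].
   Reversing makes the parent of [c] simply [pr2 (pred c)]. *)
Definition component (v : nat) : nat := pr1 v.
Definition position (v : nat) : nat := pr1 (pr2 v).
Definition branch (v : nat) : nat := pr2 (pr2 v).
Definition mk_vertex (i k c : nat) : nat := pr i (pr k c).

Lemma component_mk i k c : component (mk_vertex i k c) = i.
Proof. apply pr1_pr. Qed.

Lemma position_mk i k c : position (mk_vertex i k c) = k.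
Proof. unfold position, mk_vertex. now rewrite pr2_pr, pr1_pr. Qed.

Lemma branch_mk i k c : branch (mk_vertex i k c) = c.
Proof. unfold branch, mk_vertex. now rewrite !pr2_pr. Qed.

Lemma mk_vertex_eta v : mk_vertex (component v) (position v) (branch v) = v.
Proof. unfold mk_vertex, component, position, branch. now rewrite !pr_eta. Qed.

Lemma vertex_ext u v :
  component u = component v -> position u = position v -> branch u = branch v ->
  u = v.
Proof.
  intros H1 H2 H3. rewrite <- (mk_vertex_eta u), <- (mk_vertex_eta v).
  now rewrite H1, H2, H3.
Qed.

Definition child (u v : nat) : Prop :=
  branch v <> 0 /\ branch u = pr2 (pred (branch v)) /\ position u = position v.

Definition cycle_succ (u v : nat) : Prop :=
  branch u = 0 /\ branch v = 0 /\
  (position v = S (position u) \/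
   (position u = S (S (component u)) /\ position v = 0)).

Definition glued_step (u v : nat) : Prop :=
  component u = component v /\ (cycle_succ u v \/ child u v).

Lemma pr2_le z : pr2 z <= z.
Proof.
  rewrite <- (pr_eta z) at 2.
  pose proof (Cantor.to_nat_non_decreasing (pr1 z) (pr2 z)). unfold pr. lia.
Qed.

Lemma child_branch_lt u v : child u v -> branch u < branch v.
Proof.
  intros (H & -> & _). pose proof (pr2_le (pred (branch v))). lia.
Qed.

Lemma glued_step_irrefl u : ~ glued_step u u.
Proof.
  intros [_ [(_ & _ & H)|H]]; [lia|]. apply child_branch_lt in H. lia.
Qed.

Definition glued_vertex (T : nat -> tree) (v : nat) : Prop :=
  (branch v = 0 /\ position v < S (S (component v))) \/
  (position v = S (S (component v)) /\
   exists s, branch v = list_code (rev s) /\ node (T (component v)) s).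

Definition glued_edge (T : nat -> tree) (u v : nat) : Prop :=
  (glued_step u v \/ glued_step v u) /\ glued_vertex T u /\ glued_vertex T v.

Lemma glued_edge_vertex T u v : glued_edge T u v -> glued_vertex T u.
Proof. now intros (_ & H & _). Qed.

Lemma glued_edge_sym T u v : glued_edge T u v -> glued_edge T v u.
Proof. unfold glued_edge. tauto. Qed.

Lemma glued_edge_irrefl T u : ~ glued_edge T u u.
Proof. intros [[H|H] _]; exact (glued_step_irrefl u H). Qed.

Definition glued_graph (T : nat -> tree) : graph :=
  Graph (glued_vertex T) (glued_edge T)
    (glued_edge_vertex T) (glued_edge_sym T) (glued_edge_irrefl T).

Lemma glued_vertex_position T v :
  glued_vertex T v -> position v <= S (S (component v)).
Proof. intros [[_ H]|[H _]]; lia. Qed.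

Definition prefix_code (x : nat -> nat) (j : nat) : nat :=
  list_code (rev (map x (seq 0 j))).

Lemma prefix_code_S x j : prefix_code x (S j) = S (pr (x j) (prefix_code x j)).
Proof.
  unfold prefix_code. now rewrite seq_S, map_app, rev_app_distr.
Qed.

Lemma prefix_code_lt x j k : j < k -> prefix_code x j < prefix_code x k.
Proof.
  assert (H : forall j, prefix_code x j < prefix_code x (S j)).
  { intros i. rewrite prefix_code_S.
    pose proof (pr2_le (pr (x i) (prefix_code x i))). rewrite pr2_pr in *. lia. }
  induction 1; [apply H|]. eapply Nat.lt_trans; eauto.
Qed.

Lemma path_embedding T n :
  has_path (T n) -> exists f, embedding n (glued_graph T) f.
Proof.
  intros [x Hx]. remember (S (S n)) as m eqn:Em.
  pose (f a := mk_vertex n (Nat.min a m) (prefix_code x (a - m))).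
  assert (Hv : forall a, glued_vertex T (f a)).
  { intros a. unfold glued_vertex, f.
    rewrite component_mk, position_mk, branch_mk.
    destruct (le_lt_dec m a).
    - right. split; [lia|]. eexists; split; [reflexivity|apply Hx].
    - left. replace (a - m) with 0 by lia. split; [reflexivity|lia]. }
  exists f. split; [|split].
  - intros a b E.
    pose proof (f_equal position E) as E1. pose proof (f_equal branch E) as E2.
    unfold f in E1, E2. rewrite !position_mk in E1. rewrite !branch_mk in E2.
    destruct (lt_eq_lt_dec (a - m) (b - m)) as [[l|e]|l]; try lia;
      apply (prefix_code_lt x) in l; lia.
  - intros a. split; [left|split; apply Hv].
    unfold glued_step, cycle_succ, child, f.
    rewrite !component_mk, !position_mk, !branch_mk. split; auto.
    destruct (le_lt_dec m a).
    + right. replace (S a - m) with (S (a - m)) by lia.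
      rewrite prefix_code_S. cbn [pred]. rewrite pr2_pr. repeat split; lia.
    + left. replace (a - m) with 0 by lia. replace (S a - m) with 0 by lia.
      repeat split. lia.
  - replace (n + 2) with m by lia. split; [right|split; apply Hv].
    unfold glued_step, cycle_succ, f.
    rewrite !component_mk, !position_mk, !branch_mk. split; auto.
    left. rewrite Nat.sub_diag. repeat split. lia.
Qed.

Lemma exists_argmax (g : nat -> nat) m :
  exists a, a <= m /\ forall b, b <= m -> g b <= g a.
Proof.
  induction m as [|m (a & Ha & H)].
  - exists 0. split; auto. intros b Hb. now replace b with 0 by lia.
  - destruct (le_lt_dec (g (S m)) (g a)).
    + exists a. split; [lia|]. intros b Hb.
      destruct (Nat.eq_dec b (S m)) as [->|]; auto. apply H; lia.
    + exists (S m). split; auto. intros b Hb.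
      destruct (Nat.eq_dec b (S m)) as [->|]; auto.
      specialize (H b ltac:(lia)). lia.
Qed.

Lemma glued_edge_cases T u v :
  glued_edge T u v ->
  component u = component v /\
  (cycle_succ u v \/ cycle_succ v u \/ child u v \/ child v u).
Proof. intros [[[H H']|[H H']] _]; intuition. Qed.

Lemma parent_unique u u' v :
  component u = component u' -> child u v -> child u' v -> u = u'.
Proof.
  intros H (_ & H1 & H2) (_ & H1' & H2'). apply vertex_ext; congruence.
Qed.

Section Embedded.

Variables (T : nat -> tree) (n : nat) (f : nat -> nat).
Hypothesis Hf : embedding n (glued_graph T) f.

Let i := component (f 0).

Let f_inj a b : f a = f b -> a = b.
Proof. apply Hf. Qed.

Let f_step a : glued_edge T (f a) (f (S a)).
Proof. apply Hf. Qed.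

Lemma embedded_component a : component (f a) = i.
Proof.
  induction a as [|a IH]; [reflexivity|].
  destruct (glued_edge_cases _ _ _ (f_step a)) as [E _]. congruence.
Qed.

Lemma embedded_position a : position (f a) <= S (S i).
Proof.
  rewrite <- (embedded_component a). apply (glued_vertex_position T).
  exact (glued_edge_vertex _ _ _ (f_step a)).
Qed.

Lemma embedded_neighbours a :
  a <= n + 2 ->
  exists b c, b <= n + 2 /\ c <= n + 2 /\ f b <> f c /\
  glued_edge T (f a) (f b) /\ glued_edge T (f a) (f c).
Proof.
  intros Ha.
  assert (Hchord : glued_edge T (f 0) (f (n + 2))) by apply Hf.
  assert (Hne : forall b c, b <> c -> f b <> f c) by (intros b c H E; auto).
  destruct a as [|a].
  - exists 1, (n + 2). repeat split; try apply Hne; try apply f_step;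
      try apply Hchord; lia.
  - destruct (Nat.eq_dec (S a) (n + 2)) as [E|E].
    + exists a, 0.
      split; [lia|]. split; [lia|]. split; [apply Hne; lia|].
      split; apply glued_edge_sym; [apply f_step|now rewrite E].
    + exists a, (S (S a)).
      split; [lia|]. split; [lia|]. split; [apply Hne; lia|].
      split; [apply glued_edge_sym|]; apply f_step.
Qed.

(* A vertex of the embedded cycle deepest in the tree would have its parent as
   its only neighbour in the cycle. *)
Lemma embedded_branch a : a <= n + 2 -> branch (f a) = 0.
Proof.
  destruct (exists_argmax (fun a => branch (f a)) (n + 2)) as (d & Hd & Hmax).
  cbv beta in Hmax. intros Ha. pose proof (Hmax a Ha) as Hle.
  destruct (Nat.eq_dec (branch (f d)) 0) as [|Hne]; [lia|exfalso].
  assert (Hup : forall b, b <= n + 2 -> glued_edge T (f d) (f b) ->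
            child (f b) (f d)).
  { intros b Hb He.
    destruct (glued_edge_cases _ _ _ He) as [_ [H|[H|[H|H]]]]; auto.
    - now destruct H.
    - now destruct H as (_ & H & _).
    - apply child_branch_lt in H. specialize (Hmax b Hb). lia. }
  destruct (embedded_neighbours d Hd) as (b & c & Hb & Hc & Hbc & Eb & Ec).
  apply Hbc, (parent_unique _ _ (f d)); auto.
  now rewrite !embedded_component.
Qed.

Lemma embedded_cycle_eq a b :
  a <= n + 2 -> b <= n + 2 -> position (f a) = position (f b) -> a = b.
Proof.
  intros Ha Hb E. apply f_inj, vertex_ext; auto.
  - now rewrite !embedded_component.
  - now rewrite !embedded_branch.
Qed.

Lemma embedded_adjacent a b :
  a <= n + 2 -> b <= n + 2 -> glued_edge T (f a) (f b) ->
  position (f b) = S (position (f a)) \/ position (f a) = S (position (f b)) \/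
  (position (f a) = S (S i) /\ position (f b) = 0) \/
  (position (f b) = S (S i) /\ position (f a) = 0).
Proof.
  intros Ha Hb He.
  destruct (glued_edge_cases _ _ _ He) as [_ [H|[H|[H|H]]]].
  - destruct H as (_ & _ & H). rewrite embedded_component in H. lia.
  - destruct H as (_ & _ & H). rewrite embedded_component in H. lia.
  - destruct H as [H _]. now destruct (H (embedded_branch b Hb)).
  - destruct H as [H _]. now destruct (H (embedded_branch a Ha)).
Qed.

Lemma embedded_cycle_next a :
  a <= n + 2 -> exists b, b <= n + 2 /\
  (position (f b) = S (position (f a)) \/
   (position (f a) = S (S i) /\ position (f b) = 0)).
Proof.
  intros Ha.
  destruct (embedded_neighbours a Ha) as (b & c & Hb & Hc & Hbc & Eb & Ec).
  assert (Hp : position (f b) <> position (f c))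
    by (intros E; apply Hbc; f_equal; auto using embedded_cycle_eq).
  apply (embedded_adjacent a b Ha Hb) in Eb.
  apply (embedded_adjacent a c Ha Hc) in Ec.
  pose proof (embedded_position a). pose proof (embedded_position b).
  pose proof (embedded_position c).
  destruct (Nat.eq_dec (position (f b)) (S (position (f a))));
    [exists b; auto|].
  destruct (Nat.eq_dec (position (f c)) (S (position (f a))));
    [exists c; auto|].
  destruct (Nat.eq_dec (position (f b)) 0); [exists b|exists c]; lia.
Qed.

Lemma embedded_cycle_onto k :
  k <= S (S i) -> exists a, a <= n + 2 /\ position (f a) = k.
Proof.
  assert (Hup : forall a, a <= n + 2 -> forall d, position (f a) + d <= S (S i) ->
            exists b, b <= n + 2 /\ position (f b) = position (f a) + d).
  { intros a Ha d. induction d as [|d IH]; intros Hd; [exists a; lia|].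
    destruct IH as (b & Hb & E); [lia|].
    destruct (embedded_cycle_next b Hb) as (c & Hc & E'). exists c. lia. }
  intros Hk. pose proof (embedded_position 0) as H0.
  destruct (Hup 0 ltac:(lia) (S (S i) - position (f 0)) ltac:(lia))
    as (b & Hb & Eb).
  destruct (embedded_cycle_next b Hb) as (c & Hc & Ec).
  pose proof (embedded_position c).
  destruct (Hup c Hc k ltac:(lia)) as (d & Hd & Ed). exists d. lia.
Qed.

Lemma embedded_component_eq : i = n.
Proof.
  pose (l := map (fun a => position (f a)) (seq 0 (n + 3))).
  assert (Hl : length l = n + 3) by (unfold l; now rewrite length_map, length_seq).
  assert (H1 : length l <= length (seq 0 (i + 3))).
  { apply NoDup_incl_length.
    - apply NoDup_map_NoDup_ForallPairs; [|apply seq_NoDup].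
      intros a b Ha Hb E. apply in_seq in Ha, Hb.
      apply embedded_cycle_eq; auto; lia.
    - intros k Hk. apply in_map_iff in Hk as (a & <- & _). apply in_seq.
      pose proof (embedded_position a). lia. }
  assert (H2 : length (seq 0 (i + 3)) <= length l).
  { apply NoDup_incl_length; [apply seq_NoDup|].
    intros k Hk. apply in_seq in Hk.
    destruct (embedded_cycle_onto k ltac:(lia)) as (a & Ha & <-).
    apply (in_map (fun a => position (f a))), in_seq. lia. }
  rewrite length_seq in H1, H2. lia.
Qed.

Lemma embedded_ray_branch j : branch (f (S (n + 2 + j))) <> 0.
Proof.
  intros E.
  destruct (embedded_cycle_onto _ (embedded_position (S (n + 2 + j))))
    as (a & Ha & Ea).
  assert (H : a = S (n + 2 + j)); [|lia].
  apply f_inj, vertex_ext; auto.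
  - now rewrite !embedded_component.
  - now rewrite E, embedded_branch.
Qed.

Lemma embedded_ray_child j : child (f (n + 2 + j)) (f (S (n + 2 + j))).
Proof.
  pose proof (embedded_ray_branch j) as Hj.
  destruct (glued_edge_cases _ _ _ (f_step (n + 2 + j))) as [_ H].
  destruct H as [(_ & H & _)|[(H & _)|[H|H]]]; [easy|easy|exact H|exfalso].
  induction j as [|j IH].
  - destruct H as [H _]. apply H, embedded_branch. lia.
  - assert (Hback : child (f (n + 2 + j)) (f (n + 2 + S j))).
    { rewrite (Nat.add_succ_r (n + 2) j). pose proof (embedded_ray_branch j) as Hj'.
      destruct (glued_edge_cases _ _ _ (f_step (n + 2 + j))) as [_ H'].
      destruct H' as [(_ & H' & _)|[(H' & _)|[H'|H']]]; [easy|easy|exact H'|].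
      now destruct (IH Hj' H'). }
    assert (E : n + 2 + j = S (n + 2 + S j)); [|lia].
    apply f_inj, (parent_unique _ _ (f (n + 2 + S j))); auto.
    now rewrite !embedded_component.
Qed.

Lemma embedded_path : has_path (T n).
Proof.
  pose (x j := pr1 (pred (branch (f (S (n + 2 + j)))))).
  assert (Hx : forall j, branch (f (n + 2 + j)) = prefix_code x j).
  { induction j as [|j IH].
    - apply embedded_branch. lia.
    - rewrite prefix_code_S, <- IH, (Nat.add_succ_r (n + 2) j). unfold x.
      destruct (embedded_ray_child j) as (H & -> & _). rewrite pr_eta. lia. }
  assert (Hpos : forall j, node (T n) (map x (seq 0 (S j)))).
  { intros j. pose proof (embedded_ray_branch j) as Hj.
    destruct (glued_edge_vertex _ _ _ (f_step (S (n + 2 + j))))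
      as [[H _]|(_ & s & Hs & Hn)]; [easy|].
    rewrite embedded_component, embedded_component_eq in Hn.
    rewrite <- (Nat.add_succ_r (n + 2) j), Hx in Hs. apply list_code_inj in Hs.
    apply (f_equal (@rev nat)) in Hs. rewrite !rev_involutive in Hs.
    now rewrite Hs. }
  exists x. intros [|j]; [|apply Hpos]. exact (node_prefix _ [] _ (Hpos 0)).
Qed.

End Embedded.

Lemma glued_graph_embedding T n :
  has_path (T n) <-> exists f, embedding n (glued_graph T) f.
Proof.
  split; [apply path_embedding|]. intros [f Hf]. exact (embedded_path T n f Hf).
Qed.

Definition rev_step (r : nat) : nat :=
  if pr2 r =? 0 then r
  else pr (S (pr (pr1 (pred (pr2 r))) (pr1 r))) (pr2 (pred (pr2 r))).

Definition rev_code (c : nat) : nat := pr1 (Nat.iter c rev_step (pr 0 c)).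

Lemma rev_code_list_code s : rev_code (list_code s) = list_code (rev s).
Proof.
  assert (H : forall s acc k, length s <= k ->
            Nat.iter k rev_step (pr (list_code acc) (list_code s)) =
            pr (list_code (rev_append s acc)) 0).
  { clear s. intros s acc k. revert s acc.
    induction k as [|k IH]; intros [|x s] acc Hk; simpl in Hk; try lia;
      [reflexivity| |]; rewrite Nat.iter_succ_r; unfold rev_step at 2;
      rewrite ?pr1_pr, ?pr2_pr; cbn [list_code Nat.eqb pred].
    - apply (IH []). apply Nat.le_0_l.
    - rewrite pr1_pr, pr2_pr. apply (IH s (x :: acc)). lia. }
  specialize (H s [] _ (length_le_list_code s)). cbn [list_code] in H.
  unfold rev_code. now rewrite H, pr1_pr, rev_append_rev, app_nil_r.
Qed.

Definition glued_vertex_test (p : baire) (v : nat) : bool :=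
  ((branch v =? 0) && (position v <? S (S (component v)))) ||
  ((position v =? S (S (component v))) &&
   (p (pr (component v) (rev_code (branch v))) =? 1)).

Definition glued_step_test (u v : nat) : bool :=
  (component u =? component v) &&
  ((branch u =? 0) && (branch v =? 0) &&
   ((position v =? S (position u)) ||
    ((position u =? S (S (component u))) && (position v =? 0))) ||
   (negb (branch v =? 0) && (branch u =? pr2 (pred (branch v))) &&
    (position u =? position v))).

Definition glued_graph_name (p : baire) (e : nat) : nat :=
  Nat.b2n (if pr1 e =? pr2 e then glued_vertex_test p (pr1 e)
           else (glued_step_test (pr1 e) (pr2 e) || glued_step_test (pr2 e) (pr1 e)) &&
                (glued_vertex_test p (pr1 e) && glued_vertex_test p (pr2 e))).

Lemma computable_glued_graph_name : computable glued_graph_name.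
Proof.
  unfold glued_graph_name, glued_vertex_test, glued_step_test, rev_code, rev_step,
    component, position, branch.
  computability.
Qed.

Lemma glued_vertex_testP p T v :
  seq_name tree_space p T -> glued_vertex_test p v = true <-> glued_vertex T v.
Proof.
  intros Hp. unfold glued_vertex_test, glued_vertex.
  destruct (list_code_surj (branch v)) as [s Hs].
  rewrite <- Hs, rev_code_list_code.
  rewrite orb_true_iff, !andb_true_iff,
    (char_val_eq1 _ _ (Hp (component v) (rev s))), !Nat.eqb_eq, Nat.ltb_lt.
  enough (E : node (T (component v)) (rev s) <->
          exists t, list_code s = list_code (rev t) /\ node (T (component v)) t)
    by tauto.
  split.
  - exists (rev s). now rewrite rev_involutive.
  - intros (t & Ht & H). apply list_code_inj in Ht. subst s.
    now rewrite rev_involutive.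
Qed.

Lemma glued_step_testP u v : glued_step_test u v = true <-> glued_step u v.
Proof.
  unfold glued_step_test, glued_step, cycle_succ, child.
  rewrite !andb_true_iff, !orb_true_iff, !andb_true_iff, !orb_true_iff,
    !andb_true_iff, negb_true_iff, !Nat.eqb_eq, Nat.eqb_neq. tauto.
Qed.

Lemma WF_hat_le_S_L : sW_le WF_hat S_L.
Proof.
  apply (sW_le_complement (X := seq_space tree_space) (Z := graph_space)
           WF_hat S_L glued_graph_name glued_graph).
  - apply computable_glued_graph_name.
  - intros p T Hp. split.
    + intros v. unfold glued_graph_name. rewrite pr1_pr, pr2_pr, Nat.eqb_refl.
      now apply char_val_b2n, glued_vertex_testP.
    + intros u v Huv. unfold glued_graph_name. rewrite pr1_pr, pr2_pr.
      rewrite (proj2 (Nat.eqb_neq _ _) Huv). apply char_val_b2n.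
      rewrite !andb_true_iff, orb_true_iff, !glued_step_testP.
      rewrite !(glued_vertex_testP p T) by exact Hp. reflexivity.
  - apply S_L_total.
  - intros T w Hw n. specialize (Hw n).
    rewrite subgraph_L_cycle_iff, <- glued_graph_embedding in Hw.
    rewrite negb_false_iff, negb_true_iff. split; [tauto|].
    intros H. destruct (w n); tauto.
Qed.

Theorem theorem27 : sW_equiv WF_hat S_L.
Proof. exact (conj WF_hat_le_S_L S_L_le_WF_hat). Qed.
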